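(* Let $\mu\in\mathcal{M}(\mathbb{R}^n)$ and suppose that there exists a dual measure $\mu^*\in\mathcal{M}(\mathbb{R}^n)$ of $\mu$. Then $$\ell''_{\mu^*}(m)=\big(V_{F(\mu)}(m)\big)^{-1}\qquad\text{for all } m\in M_{F(\mu)}.$$ Furthermore, if $\mu$ is steep, then $$\ell''_{\mu}(m)=\big(V_{F(\mu^* )}(m)\big)^{-1}\qquad\text{for all } m\in S(\mu).$$
   Context: For a positive measure $\mu$ on $\mathbb{R}^n$ let $B_\mu(s)=\int_{\mathbb{R}^n}e^{-\langle s,x\rangle}\mu(dx)$ (called its Laplace transform), let $S(\mu)$ be the interior of $\{s: B_\mu(s)<\infty\}$, and $\ell_\mu=\log B_\mu$. $\mathcal{M}(\mathbb{R}^n)$ is the set of positive (possibly unbounded) measures $\mu$ on $\mathbb{R}^n$ that are not concentrated on an affine hyperplane and satisfy $S(\mu)\neq\emptyset$. For $\mu\in\mathcal{M}(\mathbb{R}^n)$, the natural exponential family is $F(\mu)=\{P(-s,\mu): s\in S(\mu)\}$ with $P(-s,\mu)(dx)=e^{-\langle s,x\rangle-\ell_\mu(s)}\mu(dx)$. The mean of $P(-s,\mu)$ is $m=-\ell'_\mu(s)$ ($\ell'_\mu$ is the gradient, $\ell''_\mu$ the Hessian matrix); the map $s\mapsto -\ell_\mu'(s)$ is injective on $S(\mu)$, its image $M_{F(\mu)}$ is the domain of the means, and its inverse is $\varphi_\mu:M_{F(\mu)}\to S(\mu)$. The variance function is $V_{F(\mu)}(m)=\ell''_\mu(\varphi_\mu(m))$,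 $m\in M_{F(\mu)}$, the covariance matrix of the member of $F(\mu)$ with mean $m$. $\mu$ is steep if $M_{F(\mu)}$ equals the interior of the closed convex hull of the support of $\mu$. A measure $\mu^*\in\mathcal{M}(\mathbb{R}^n)$ is a dual measure of $\mu$ if $M_{F(\mu)}\subset S(\mu^* )$ and $-\ell'_{\mu^*}(-\ell'_\mu(s))=s$ for all $s\in S(\mu)$ (it is unique up to a positive multiplicative constant). *)

(* Defs.v *)
From HB Require Import structures.
From mathcomp Require Import all_boot all_order all_algebra.
From mathcomp Require Import all_classical all_reals all_analysis.
Set Implicit Arguments.
Unset Strict Implicit.
Unset Printing Implicit Defensive.
Import Order.TTheory GRing.Theory Num.Theory.
Import numFieldNormedType.Exports.
Local Open Scope classical_set_scope.
Local Open Scope ring_scope.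

(* R^n with its Borel sigma-algebra *)
Notation borelRn R n := (g_sigma_algebraType (@open 'rV[R]_n)).

Section calculus.
Context {R : realType} {n : nat}.
Implicit Types (f : 'rV[R]_n -> R) (s x : 'rV[R]_n).

Definition dot s x : R := \sum_(i < n) s ord0 i * x ord0 i.

Definition partial f (i : 'I_n) : 'rV[R]_n -> R := 'D_(delta_mx ord0 i) f.

Definition gradient f s : 'rV[R]_n := \row_i partial f i s.

Definition hessian f s : 'M[R]_n := \matrix_(i, j) partial (partial f j) i s.

Definition closed_convex_hull (A : set 'rV[R]_n) : set 'rV[R]_n :=
  smallest [set C : set 'rV[R]_n | closed C /\ convex_set C] A.

Definition affine_hyperplane (H : set 'rV[R]_n) : Prop :=
  exists a b, a != 0 /\ H = [set x | dot a x = b].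

End calculus.

Section natural_exponential_families.
Context {R : realType} {n : nat}.
Implicit Types mu nu : {measure set (borelRn R n) -> \bar R}.

Definition laplace mu (s : 'rV[R]_n) : \bar R :=
  (\int[mu]_x (expR (- dot s x))%:E)%E.

Definition Sdom mu : set 'rV[R]_n := interior [set s | (laplace mu s < +oo)%E].

(* Meaningful where the transform is finite (in particular on [Sdom mu]). *)
Definition ell mu (s : 'rV[R]_n) : R := ln (fine (laplace mu s)).

Definition concentrated_on mu (H : set 'rV[R]_n) : Prop := mu (~` H) = 0%E.

Definition classM mu : Prop :=
  (forall H, affine_hyperplane H -> ~ concentrated_on mu H) /\ Sdom mu !=set0.

(* The mean of P(-s, mu), where P(-s, mu)(dx) = exp(- <s, x> - ell mu s) mu(dx) *)
Definition mean_map mu (s : 'rV[R]_n) : 'rV[R]_n := - gradient (ell mu) s.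

Definition domain_of_means mu : set 'rV[R]_n := mean_map mu @` Sdom mu.

(* Inverse of [mean_map mu] on [Sdom mu], with value 0 off [domain_of_means mu] *)
Definition phi mu : 'rV[R]_n -> 'rV[R]_n :=
  'pinv_(fun=> 0) (Sdom mu) (mean_map mu).

Definition variance_function mu (m : 'rV[R]_n) : 'M[R]_n :=
  hessian (ell mu) (phi mu m).

Definition supp mu : set 'rV[R]_n :=
  [set x | forall U : set 'rV[R]_n, open U -> U x -> (0 < mu U)%E].

Definition steep mu : Prop :=
  domain_of_means mu = interior (closed_convex_hull (supp mu)).

Definition is_dual mu nu : Prop :=
  [/\ classM nu,
      domain_of_means mu `<=` Sdom nu &
      forall s, Sdom mu s -> mean_map nu (mean_map mu s) = s].

(* Hence [variance_function nu] is evaluated inside its domain on [Sdom mu]. *)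
Lemma is_dual_Sdom_sub mu nu : is_dual mu nu -> Sdom mu `<=` domain_of_means nu.
Proof.
by case=> _ sub inv s Ss; exists (mean_map mu s); [apply: sub; exists s|exact: inv].
Qed.

End natural_exponential_families.

(* [invmx V] is [V] itself when [V] is singular, hence the first conjunct. *)
Definition is_inverse_of {R : realType} {n : nat} (A V : 'M[R]_n) : Prop :=
  V \in unitmx /\ A = invmx V.

(* Main.v *)
Require Import Defs.
From HB Require Import structures.
From mathcomp Require Import all_boot all_order all_algebra.
From mathcomp Require Import all_classical all_reals all_analysis.
From mathcomp Require Import measurable_realfun ring lra.
Set Implicit Arguments.
Unset Strict Implicit.
Unset Printing Implicit Defensive.
Import Order.TTheory GRing.Theory Num.Theory.
Import numFieldNormedType.Exports.
Local Open Scope classical_set_scope.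
Local Open Scope ring_scope.

(** The duality relation says that the mean map [s |-> - ell_nu'(s)] is a left
inverse of [s |-> - ell_mu'(s)] on [Sdom mu].  Both maps are differentiable,
with Jacobian minus the Hessian of the cumulant function, so the chain rule
turns this relation into [ell_mu''(s) ell_nu''(m) = 1] for [m] the mean at [s]
([hessian_dual]); the two signs cancel.  This is both claims at once, provided
that [phi mu] sends [m] to [s] and [phi nu] sends [s] to [m], that is, provided
that the two mean maps are injective ([mean_map_inj], [phiK]).

Smoothness rests on the weighted transforms
[wlaplace g s = int g(x) exp(- <s, x>) mu(dx)] of measurable functions [g] that
grow more slowly than every exponential of the norm.  This class contains the
constants and the linear forms, and it is stable under products, so one theorem
([is_diff_wlaplace]) differentiates the transform as often as needed: the
differential at [s] is [v |-> - wlaplace (g * <v, .>) s].  It is obtained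
directly from the second order Taylor bound for the exponential, because for [s]
in the interior of the domain of finiteness some [exp(c |x| - <s, x>)] with
[c > 0] is integrable ([tilt_envelope]) and dominates the remainder.

For injectivity, suppose that [s] and [t = s + v] have the same mean [m], and put
[w(x) = <v, x - m>].  Both tilted integrals of [w] vanish, hence so does a
combination of them, the integral of [w (1 - exp(- w)) exp(- <s, x>)].  That
integrand is nonnegative and vanishes only where [w] does, so [mu] is
concentrated on the hyperplane [w = 0] unless [v = 0]. *)

(** * Differentials of maps between normed spaces and row vectors *)

Section differentials.
Context {R : realType}.

(** Differentiability is a local property: it lets formulas that are valid only
on the open set [Sdom mu] be differentiated there. *)
Lemma near_eq_is_diff (V W : normedModType R) (f g df : V -> W) (x : V) :
  (\forall y \near x, f y = g y) -> is_diff x f df -> is_diff x g df.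
Proof.
move=> fg [dfx dfE]; have fgx := nbhs_singleton fg.
have eps : g \o shift x = cst (g x) + 'd f x +o_ 0 id.
  apply/eqaddoP => e e0; have /eqaddoP/(_ e e0) := diff_locally dfx.
  move: fg; rewrite (near_shift 0 x) => fg.
  apply: filterS2 fg => y /=; rewrite subr0 => fgy.
  by rewrite !fctE /= fgy fgx.
have dgE : 'd g x = 'd f x :> (V -> W).
  by apply: diff_unique => //; exact: diff_continuous.
apply: DiffDef; last by rewrite dgE.
by apply/diff_locallyP; rewrite dgE; split => //; exact: diff_continuous.
Qed.

(** A quadratic bound on the remainder in some ball is an effective form of the
[o(h)] condition, and is what a domination argument produces. *)
Lemma is_diff_quadratic (V W : normedModType R) (f : V -> W)
    (df : {linear V -> W}) (x : V) (c K : R) : 0 < c -> continuous df ->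
  (forall h, `|h| <= c -> `|f (h + x) - f x - df h| <= K * `|h| ^+ 2) ->
  is_diff x f df.
Proof.
move=> c0 dfc fK.
have eps : f \o shift x = cst (f x) + df +o_ 0 id.
  apply/eqaddoP => e e0.
  have K0 : 0 < `|K| + 1 by rewrite ltr_wpDl.
  have d0 : 0 < Num.min c (e / (`|K| + 1)) by rewrite lt_min c0 divr_gt0.
  near=> h.
  have hd : `|h| <= Num.min c (e / (`|K| + 1)).
    by near: h; apply: nbhs0_le.
  move: hd; rewrite le_min => /andP[hc he].
  have := fK h hc; rewrite -addrA -opprD => /le_trans; apply.
  rewrite expr2 mulrA ler_wpM2r// (le_trans (ler_wpM2r _ (ler_norm K)))//.
  move: he; rewrite ler_pdivlMr// mulrDr mulr1 mulrC; apply: le_trans.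
  by rewrite lerDl.
have dE : 'd f x = df :> (V -> W) by apply: diff_unique.
by apply: DiffDef => //; apply/diff_locallyP; rewrite dE.
Unshelve. all: by end_near. Qed.

Lemma rV_linear_continuous n (W : normedModType R) (f : {linear 'rV[R]_n -> W}) :
  continuous f.
Proof.
have -> : (f : _ -> _) =
    \sum_i (fun x : 'rV[R]_n => x ord0 i *: f (delta_mx ord0 i)).
  apply/funext => x; rewrite [in LHS](row_sum_delta x) linear_sum fct_sumE.
  by apply: eq_bigr => i _; rewrite linearZ.
move=> x; apply: differentiable_continuous.
by apply: differentiable_sum => i; apply: differentiableZl;
  exact: differentiable_coord.
Qed.

Lemma differentiable_row (V : normedModType R) n (f : V -> 'rV[R]_n) (x : V) :
  (forall i, differentiable (fun y => f y ord0 i) x) -> differentiable f x.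
Proof.
move=> df.
have -> : f = \sum_i (fun y : V => f y ord0 i *: delta_mx ord0 i).
  by apply/funext => y; rewrite fct_sumE -row_sum_delta.
by apply: differentiable_sum => i; exact: differentiableZl.
Qed.

Lemma diff_row (V : normedModType R) n (f : V -> 'rV[R]_n) (x v : V) i :
  differentiable f x -> 'd f x v ord0 i = 'd (fun y => f y ord0 i) x v.
Proof.
move=> df; have dc := differentiable_coord (f x) ord0 i.
have lc : linear (fun M : 'rV[R]_n => M ord0 i : R).
  by move=> a M N; rewrite !mxE.
pose clM := GRing.isLinear.Build _ _ _ _ _ lc.
pose cL : {linear 'rV[R]_n -> R} := HB.pack (fun M : 'rV[R]_n => M ord0 i : R) clM.
have -> : (fun y => f y ord0 i) = cL \o f by [].
rewrite (diff_comp df (dc : differentiable cL (f x))) [RHS]/=.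
by rewrite (@diff_lin _ _ _ cL)//; exact: rV_linear_continuous.
Qed.

End differentials.

(** * Growth of exponentials and of linear forms *)

(** From [1 + u <= exp u] and the same bound at [- u] follow
[0 <= exp u - 1 - u <= u (exp u - 1)], and [exp u - 1] is in turn at most
[|u| exp |u|] in absolute value. *)
Lemma expR_taylor2 (R : realType) (u : R) :
  `|expR u - 1 - u| <= u ^+ 2 * expR `|u|.
Proof.
have lo := expR_ge1Dx u.
have hi : expR u - 1 <= u * expR u.
  have := expR_ge1Dx (- u); rewrite expRN => h.
  have e0 := expR_gt0 u.
  have : (1 - u) * expR u <= 1 by rewrite -ler_pdivlMr ?div1r.
  lra.
rewrite ger0_norm; last lra.
case: (lerP 0 u) => u0.
  rewrite ger0_norm//.
  apply: (@le_trans _ _ (u * (expR u - 1))); first lra.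
  by rewrite expr2 -mulrA ler_wpM2l//.
rewrite ltr0_norm//.
have e1 : 1 <= expR (- u) by rewrite -expR0 ler_expR; lra.
apply: (@le_trans _ _ (u ^+ 2)); first by nra.
by rewrite ler_peMr// sqr_ge0.
Qed.

Section growth.
Context {R : realType} {n : nat}.
Implicit Types (x v s : 'rV[R]_n) (g : 'rV[R]_n -> R).

Lemma dotDl s v x : dot (s + v) x = dot s x + dot v x.
Proof. by rewrite /dot -big_split; apply: eq_bigr => i _; rewrite mxE mulrDl. Qed.

Lemma dotZl (a : R) v x : dot (a *: v) x = a * dot v x.
Proof. by rewrite /dot mulr_sumr; apply: eq_bigr => i _; rewrite mxE mulrA. Qed.

Lemma dotNl v x : dot (- v) x = - dot v x.
Proof. by rewrite -scaleN1r dotZl mulN1r. Qed.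

Lemma dotBl s v x : dot (s - v) x = dot s x - dot v x.
Proof. by rewrite dotDl dotNl. Qed.

Lemma dot_delta i x : dot (delta_mx ord0 i) x = x ord0 i.
Proof.
rewrite /dot (bigD1 i)//= mxE !eqxx mul1r big1 ?addr0// => j ji.
by rewrite mxE eqxx (negbTE ji) mul0r.
Qed.

Lemma ler_coord_norm x i : `|x ord0 i| <= `|x|.
Proof.
rewrite [leRHS]/Num.norm /= mx_normrE.
exact: (le_bigmax _ (fun ij => `|x ij.1 ij.2|) (ord0, i)).
Qed.

Lemma dot_norm v x : `|dot v x| <= n%:R * `|v| * `|x|.
Proof.
rewrite /dot (le_trans (ler_norm_sum _ _ _))//.
have -> : n%:R * `|v| * `|x| = \sum_(i < n) `|v| * `|x|.
  by rewrite sumr_const card_ord -mulrA mulr_natl.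
by apply: ler_sum => i _; rewrite normrM ler_pM// ler_coord_norm.
Qed.

Lemma dot_continuous v : continuous (dot v).
Proof.
have -> : dot v = \sum_i (v ord0 i *: (fun x : 'rV[R]_n => x ord0 i)).
  by apply/funext => x; rewrite fct_sumE.
move=> x; apply: differentiable_continuous; apply: differentiable_sum => i.
by apply: differentiableZ; exact: differentiable_coord.
Qed.

(** The norm is the maximum of the [|x_i|], so the left-hand side is one of
[exp (c |x_i|)]; the summand [1] accounts for the empty maximum in dimension
zero. Each term on the right is the exponential of a linear form, hence its
tilted integral is a value of the Laplace transform. *)
Lemma expR_norm_le_sum (c : R) x : 0 <= c ->
  expR (c * `|x|) <= 1 + \sum_i (expR (c * x ord0 i) + expR (- (c * x ord0 i))).
Proof.
move=> c0; set S := \sum_i _.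
have S0 : 0 <= S by apply: sumr_ge0 => i _; rewrite addr_ge0// expR_ge0.
rewrite [`|x|]/Num.norm /= mx_normrE.
elim/big_ind : _ => [|a b a1 b1|[i j] _ /=].
- by rewrite mulr0 expR0 lerDl.
- by rewrite maxEle; case: ifP.
rewrite ord1 /S (bigD1 j)//=.
have := expR_ge0 (c * x ord0 j); have := expR_ge0 (- (c * x ord0 j)).
have : 0 <= \sum_(k < n | k != j)
    (expR (c * x ord0 k) + expR (- (c * x ord0 k))).
  by apply: sumr_ge0 => k _; rewrite addr_ge0// expR_ge0.
case: (lerP 0 (x ord0 j)) => xj.
  rewrite ger0_norm//; lra.
rewrite ltr0_norm// mulrN; lra.
Qed.

(** Growth of exponential type zero, the class of weights that an exponential
with integrable tilt absorbs whatever its rate. *)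
Definition subexponential g := forall e : R, 0 < e ->
  exists A, forall x, `|g x| <= A * expR (e * `|x|).

Lemma subexponential_cst (a : R) : subexponential (cst a).
Proof.
move=> e e0; exists `|a| => x /=; rewrite ler_peMr// -expR0 ler_expR.
by rewrite mulr_ge0// ltW.
Qed.

Lemma subexponential_le g h : (forall x, `|g x| <= `|h x|) ->
  subexponential h -> subexponential g.
Proof.
move=> gh sh e /sh[A hA]; exists A => x; exact: le_trans (hA x).
Qed.

Lemma subexponential_norm : subexponential (fun x => `|x|).
Proof.
move=> e e0; exists e^-1 => x; rewrite normr_id.
rewrite mulrC ler_pdivlMr// mulrC.
by apply: le_trans (expR_ge1Dx _); rewrite lerDr.
Qed.

Lemma subexponentialM g h : subexponential g -> subexponential h ->
  subexponential (g \* h).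
Proof.
move=> sg sh e e0; have e2 : 0 < e / 2 by rewrite divr_gt0.
have [A gA] := sg _ e2; have [B hB] := sh _ e2; exists (A * B) => x /=.
rewrite normrM (splitr e) mulrDl expRD mulrACA.
by rewrite ler_pM.
Qed.

Lemma subexponential_dot v : subexponential (dot v).
Proof.
apply: (@subexponential_le _ (cst (n%:R * `|v|) \* (fun x => `|x|))).
  by move=> x; rewrite (le_trans (dot_norm _ _))//= ler_norm.
by apply: subexponentialM; [exact: subexponential_cst|exact: subexponential_norm].
Qed.

End growth.

(** * Borel measurability of continuous functions *)

Section borel.
Context {R : realType} {n : nat}.

Lemma continuous_borel_measurable (f : 'rV[R]_n -> R) : continuous f ->
  measurable_fun [set: borelRn R n] (f : borelRn R n -> R).
Proof.
move=> /continuousP cf; apply: (measurability _ (RGenOpens.measurableE R)).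
move=> _ [_ [a [b ->]] <-]; rewrite setTI.
by apply: sub_sigma_algebra; apply: cf; exact: interval_open.
Qed.

Lemma measurable_dot v : measurable_fun [set: borelRn R n] (dot v).
Proof. by apply: continuous_borel_measurable; exact: dot_continuous. Qed.

End borel.

(** * Weighted Laplace transforms *)

Section transforms.
Context {R : realType} {n : nat}.
Context (mu : {measure set (borelRn R n) -> \bar R}).
Implicit Types (s v x : 'rV[R]_n) (g : 'rV[R]_n -> R).

Notation integrableT f := (mu.-integrable setT (EFin \o f)).

Definition tilt s g x : R := g x * expR (- dot s x).

Definition wlaplace g s : R := Rintegral mu setT (tilt s g).

Lemma measurable_tilt s g : measurable_fun [set: borelRn R n] g ->
  measurable_fun [set: borelRn R n] (tilt s g).
Proof.
move=> mg; apply: measurable_funM => //.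
apply: measurableT_comp => //.
by apply: measurable_funN; exact: measurable_dot.
Qed.

Lemma measurable_norm : measurable_fun [set: borelRn R n] (fun x => `|x|).
Proof. by apply: continuous_borel_measurable; exact: norm_continuous. Qed.

Lemma integrable_tilt1 s : (laplace mu s < +oo)%E -> integrableT (tilt s (cst 1)).
Proof.
move=> sfin; apply/integrableP; split.
  by apply/measurable_EFinP; apply: measurable_tilt.
under eq_integral do rewrite /= /tilt mul1r ger0_norm ?expR_ge0//.
exact: sfin.
Qed.

(** Since [s] is interior, the Laplace transform is finite at [s] and at
[s +- c e_i] for small [c]; [expR_norm_le_sum] bounds the integrand by the sum of
the corresponding integrands. *)
Lemma tilt_envelope s : Sdom mu s -> exists2 c, 0 < c &
  integrableT (tilt s (fun x => expR (c * `|x|))).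
Proof.
move=> /nbhs_ballP[e /= e0 es]; exists (e / 2) => [|]; first by rewrite divr_gt0.
set c := e / 2; have c0 : 0 < c by rewrite divr_gt0.
have near_s v : `|v| < e -> integrableT (tilt (s + v) (cst 1)).
  move=> ve; apply: integrable_tilt1; apply: es.
  by rewrite -ball_normE /ball_/= opprD addrA subrr add0r normrN.
have cE i : `|c *: delta_mx ord0 i : 'rV[R]_n| < e.
  rewrite normrZ gtr0_norm// (@le_lt_trans _ _ c)//; last by rewrite /c; lra.
  rewrite ler_piMr ?(ltW c0)// /Num.norm /= mx_normrE; apply/bigmax_leP.
  split=> // -[j k] _ /=; rewrite mxE; case: (_ && _); by rewrite ?normr1 ?normr0.
have int_sum : integrableT (fun x => tilt s (cst 1) x +
    \sum_i (tilt (s - c *: delta_mx ord0 i) (cst 1) x +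
            tilt (s + c *: delta_mx ord0 i) (cst 1) x)).
  pose t v := EFin \o tilt (s + v) (cst 1).
  pose d i : 'rV[R]_n := c *: delta_mx ord0 i.
  have -> : EFin \o (fun x => tilt s (cst 1) x +
      \sum_i (tilt (s - d i) (cst 1) x + tilt (s + d i) (cst 1) x)) =
      (t 0%R \+ (fun x => \sum_i (t (- d i)%R \+ t (d i)) x))%E.
    by apply/funext => x; rewrite /t addr0 /= EFinD -sumEFin.
  apply: integrableD => //.
    by apply: near_s; rewrite normr0.
  apply: integrable_sum => // i _; apply: integrableD => //; apply: near_s.
    by rewrite normrN; exact: cE.
  exact: cE.
apply: le_integrable int_sum => //.
  apply/measurable_EFinP; apply: measurable_tilt.
  by apply: measurableT_comp => //; apply: measurable_funM => //; exact: measurable_norm.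
move=> x _ /=; rewrite lee_fin ger0_norm; last by rewrite mulr_ge0// expR_ge0.
apply: le_trans (ler_norm _).
rewrite /tilt mul1r; have := expR_norm_le_sum x (ltW c0).
rewrite -(ler_pM2r (expR_gt0 (- dot s x))) => /le_trans; apply.
rewrite mulrDl mul1r lerD2l mulr_suml ler_sum// => i _.
rewrite !mul1r dotBl dotDl dotZl dot_delta mulrDl -!expRD opprB opprD.
by rewrite [- dot s x - _]addrC.
Qed.

Lemma integrable_tilt s g : measurable_fun [set: borelRn R n] g ->
  subexponential g -> Sdom mu s -> integrableT (tilt s g).
Proof.
move=> mg sg /tilt_envelope[c c0 ic]; have [A gA] := sg _ c0.
have := @integrableZl _ _ _ mu _ measurableT A _ ic.
apply: le_integrable => //; first by apply/measurable_EFinP; exact: measurable_tilt.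
move=> x _ /=; rewrite lee_fin /tilt normrM (ger0_norm (expR_ge0 _)).
by apply: le_trans (ler_norm _); rewrite mulrA ler_wpM2r ?expR_ge0.
Qed.

Lemma wlaplaceD g h s : measurable_fun [set: borelRn R n] g ->
  measurable_fun [set: borelRn R n] h -> subexponential g -> subexponential h ->
  Sdom mu s -> wlaplace (g \+ h) s = wlaplace g s + wlaplace h s.
Proof.
move=> mg mh sg sh Ss; rewrite /wlaplace -RintegralD//; try exact: integrable_tilt.
by congr Rintegral; apply/funext => x; rewrite /tilt mulrDl.
Qed.

Lemma wlaplaceZ a g s : measurable_fun [set: borelRn R n] g ->
  subexponential g -> Sdom mu s -> wlaplace (a *: g) s = a * wlaplace g s.
Proof.
move=> mg sg Ss; rewrite /wlaplace -RintegralZl//; last exact: integrable_tilt.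
by congr Rintegral; apply/funext => x; rewrite /tilt mulrA.
Qed.

Section differential.
Context (g : 'rV[R]_n -> R) (mg : measurable_fun [set: borelRn R n] g)
  (sg : subexponential g).

Let mgdot v : measurable_fun [set: borelRn R n] (g \* dot v).
Proof. by apply: measurable_funM => //; exact: measurable_dot. Qed.

Let sgdot v : subexponential (g \* dot v).
Proof. by apply: subexponentialM => //; exact: subexponential_dot. Qed.

Lemma wlaplace_dot_linear s : Sdom mu s ->
  linear (fun v => - wlaplace (g \* dot v) s : R).
Proof.
move=> Ss a v w.
have -> : g \* dot (a *: v + w) = (a *: (g \* dot v)) \+ (g \* dot w).
  by apply/funext => x /=; rewrite dotDl dotZl mulrDr mulrCA.
rewrite wlaplaceD ?wlaplaceZ//; first by rewrite opprD scalerN.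
  by apply: (@measurable_funM _ _ _ _ (cst a)).
by apply: (@subexponentialM _ _ (cst a)) => //; exact: subexponential_cst.
Qed.

(** The remainder of order one is the integral of
[g(x) exp(- <s, x>) (exp(- <h, x>) - 1 + <h, x>)]. By [expR_taylor2] it is at most
[|h|^2] times the integral of [|g(x)| |x|^2 exp(n |h| |x| - <s, x>)] up to a
constant. Half of the rate [c] of the integrable envelope absorbs
[exp(n |h| |x|)] for small [h], the other half absorbs [|g(x)| |x|^2]. *)
Lemma is_diff_wlaplace s : Sdom mu s ->
  is_diff s (wlaplace g) (fun v => - wlaplace (g \* dot v) s).
Proof.
move=> Ss.
pose dM := GRing.isLinear.Build _ _ _ _ _ (wlaplace_dot_linear Ss).
pose dL : {linear 'rV[R]_n -> R} :=
  HB.pack (fun v => - wlaplace (g \* dot v) s : R) dM.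
have [c c0 ic] := tilt_envelope Ss.
have Sopen : open (Sdom mu) by exact: open_interior.
have /nbhs_ballP[r /= r0 rS] := open_nbhs_nbhs (conj Sopen Ss).
pose q x := `|x| * `|x|.
have mq : measurable_fun [set: borelRn R n] q.
  by apply: measurable_funM; exact: measurable_norm.
have sgq : subexponential (g \* q).
  apply: subexponentialM => //.
  by apply: subexponentialM; exact: subexponential_norm.
have c2 : 0 < c / 2 by rewrite divr_gt0.
have [A gA] := sgq _ c2.
pose env := wlaplace (fun x => expR (c * `|x|)) s.
(* Staying within r / 2 keeps s + h in the domain; the second bound gives
   n |h| <= c / 2, with n.+1 in place of n to avoid dividing by zero. *)
pose d := Num.min (r / 2) (c / (2 * n.+1%:R)).
have d0 : 0 < d by rewrite lt_min !divr_gt0.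
apply: (@is_diff_quadratic _ _ _ _ dL _ d (n%:R ^+ 2 * A * env)) => //.
  exact: rV_linear_continuous.
move=> h; rewrite le_min => /andP[hr hc] /=.
have Ssh : Sdom mu (h + s).
  apply: rS; rewrite -ball_normE /ball_/= opprD addrCA subrr addr0 normrN.
  by rewrite (le_lt_trans hr)//; lra.
have i1 : integrableT (tilt (h + s) g) by exact: integrable_tilt.
have i2 : integrableT (tilt s g) by exact: integrable_tilt.
have i3 : integrableT (tilt s (g \* dot h)) by exact: integrable_tilt.
have i12 : integrableT (fun x => tilt (h + s) g x - tilt s g x)
  by exact: (integrableB measurableT i1 i2).
have i123 : integrableT (fun x =>
    tilt (h + s) g x - tilt s g x + tilt s (g \* dot h) x).
  exact: (integrableD measurableT i12 i3).
rewrite opprK /wlaplace -RintegralB// -RintegralD//.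
rewrite (le_trans (le_normr_Rintegral _ _))//.
rewrite -mulrA [env * _]mulrC mulrA -RintegralZl//; apply: le_Rintegral => //.
- by apply: (integrable_abse i123).
- by have := @integrableZl _ _ _ mu _ measurableT (n%:R ^+ 2 * A * `|h| ^+ 2) _ ic.
move=> x _.
have -> : tilt (h + s) g x - tilt s g x + tilt s (g \* dot h) x =
    g x * expR (- dot s x) * (expR (- dot h x) - 1 - (- dot h x)).
  rewrite /tilt /= dotDl opprD expRD; ring.
rewrite normrM (le_trans (ler_wpM2l _ (expR_taylor2 _)))//.
have hx := dot_norm h x.
have hxc : `|dot h x| <= c / 2 * `|x|.
  apply: le_trans hx _; rewrite ler_wpM2r//.
  move: hc; rewrite ler_pdivlMr ?mulr_gt0// => hc.
  rewrite ler_pdivlMr//; apply: le_trans hc.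
  by rewrite [_ * `|h|]mulrC -mulrA ler_wpM2l// mulrC ler_wpM2l// ler_nat.
rewrite sqrrN normrN normrM (ger0_norm (expR_ge0 _)) /tilt.
have hx2 : dot h x ^+ 2 <= n%:R ^+ 2 * `|h| ^+ 2 * q x.
  rewrite -real_normK ?num_real// /q -expr2 -!exprMn.
  by rewrite lerXn2r ?nnegrE ?mulr_ge0.
have := gA x; rewrite /= normrM (ger0_norm (_ : 0 <= q x)) ?mulr_ge0// => gqA.
have -> : expR (c * `|x|) = expR (c / 2 * `|x|) * expR (c / 2 * `|x|).
  by rewrite -expRD; congr expR; field.
have e1 : expR `|dot h x| <= expR (c / 2 * `|x|) by rewrite ler_expR.
apply: (@le_trans _ _ (`|g x| * expR (- dot s x) *
    (n%:R ^+ 2 * `|h| ^+ 2 * q x * expR (c / 2 * `|x|)))).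
  by rewrite ler_wpM2l ?mulr_ge0 ?expR_ge0// ler_pM ?sqr_ge0 ?expR_ge0.
have -> : `|g x| * expR (- dot s x) *
   (n%:R ^+ 2 * `|h| ^+ 2 * q x * expR (c / 2 * `|x|)) =
  (`|g x| * q x) * (n%:R ^+ 2 * `|h| ^+ 2 * (expR (- dot s x) * expR (c / 2 * `|x|))) by ring.
apply: le_trans (ler_wpM2r _ gqA) _.
  by rewrite !mulr_ge0 ?expR_ge0 ?exprn_ge0.
by rewrite le_eqVlt; apply/orP; left; apply/eqP; ring.
Qed.

End differential.
End transforms.

(** * Cumulant functions and mean maps *)

Lemma Rintegral_eq0_null d (T : measurableType d) (R : realType)
    (mu : {measure set T -> \bar R}) (f : T -> R) :
  mu.-integrable setT (EFin \o f) -> (forall x, 0 <= f x) ->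
  Rintegral mu setT f = 0 -> mu [set x | f x != 0] = 0%E.
Proof.
move=> fi f0 if0; have mf := measurable_int mu fi.
have : (\int[mu]_x `|(EFin \o f) x| = 0)%E.
  under eq_integral do rewrite gee0_abs ?lee_fin//.
  rewrite -[LHS]fineK; last exact: integrable_fin_num.
  by congr EFin.
move=> /(ae_eq_integral_abs _ measurableT mf)[N [mN N0 fN]].
apply/eqP; rewrite -measure_le0 -N0 le_measure ?inE//.
  have := emeasurable_neq measurableT mf 0%E.
  by rewrite setTI.
by move=> x /= fx; apply: fN => /= /(_ I) [] /eqP; apply/negP.
Qed.

Section cumulants.
Context {R : realType} {n : nat}.
Context (mu : {measure set (borelRn R n) -> \bar R}).
Implicit Types (s t v x : 'rV[R]_n).

Notation L := (wlaplace mu (cst 1)).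
Notation Ldot v := (wlaplace mu (dot v)).

Lemma ell_wlaplace : ell mu = @ln R \o L.
Proof.
apply/funext => s; congr (ln (fine _)); apply: eq_integral => x _.
by rewrite /tilt mul1r.
Qed.

Lemma open_Sdom : open (Sdom mu). Proof. exact: open_interior. Qed.

Lemma near_Sdom s : Sdom mu s -> \forall t \near s, Sdom mu t.
Proof. by move=> Ss; exact: (open_nbhs_nbhs (conj open_Sdom Ss)). Qed.

Lemma integrable_tilt_cst s (a : R) : Sdom mu s ->
  mu.-integrable setT (EFin \o tilt s (cst a)).
Proof. by move=> Ss; apply: integrable_tilt => //; exact: subexponential_cst. Qed.

Lemma integrable_tilt_dot s v : Sdom mu s ->
  mu.-integrable setT (EFin \o tilt s (dot v)).
Proof.
by move=> Ss; apply: integrable_tilt => //;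
  [exact: measurable_dot|exact: subexponential_dot].
Qed.

Lemma wlaplace1_gt0 s : mu setT != 0%E -> Sdom mu s -> 0 < L s.
Proof.
move=> mu0 Ss; have t0 x : 0 <= tilt s (cst 1) x.
  by rewrite /tilt mul1r expR_ge0.
rewrite lt_neqAle; apply/andP; split; last by apply: Rintegral_ge0 => x _; exact: t0.
apply: contra mu0 => /eqP/esym/(Rintegral_eq0_null (integrable_tilt_cst 1 Ss) t0) z.
rewrite -[X in mu X](_ : [set x | tilt s (cst 1) x != 0] = _) ?z//.
apply/seteqP; split => // x _ /=; rewrite /tilt mul1r.
by rewrite gt_eqF// expR_gt0.
Qed.

Lemma is_diff_wlaplace1 s : Sdom mu s -> is_diff s L (fun v => - Ldot v s).
Proof.
move=> Ss; have := @is_diff_wlaplace _ _ mu (cst 1) (measurable_cst _)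
  (subexponential_cst 1) s Ss.
congr is_diff_def; apply/funext => v; congr (- wlaplace _ _ _).
by apply/funext => x /=; rewrite mul1r.
Qed.

Context (mu_neq0 : mu setT != 0%E).

Lemma is_diff_ell s : Sdom mu s ->
  is_diff s (ell mu) (fun v => - Ldot v s / L s).
Proof.
move=> Ss; have L0 := wlaplace1_gt0 mu_neq0 Ss.
have [dL dLE] := is_diff_wlaplace1 Ss.
have dln := is_derive1_ln L0.
have dfln : differentiable (@ln R) (L s).
  by apply/derivable1_diffP; exact: ex_derive.
rewrite ell_wlaplace; apply: DiffDef; first exact: differentiable_comp.
rewrite diff_comp// diff1E// dLE derive1E derive_val.
by apply/funext => v.
Qed.

Lemma partial_ell s i : Sdom mu s ->
  partial (ell mu) i s = - Ldot (delta_mx ord0 i) s / L s.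
Proof.
move=> Ss; have [d dE] := is_diff_ell Ss.
by rewrite /partial deriveE// dE.
Qed.

(** The mean, defined as a gradient, is the barycentre of the tilted measure:
both sides are, up to sign, the differential of the Laplace transform at [s] along
[v], computed under the integral sign and from the partial derivatives. *)
Lemma wlaplace_dot_mean s v : Sdom mu s ->
  Ldot v s = dot v (mean_map mu s) * L s.
Proof.
move=> Ss; have [d dE] := is_diff_wlaplace1 Ss.
have L0 : L s != 0 by rewrite gt_eqF// wlaplace1_gt0.
apply: oppr_inj; rewrite -[LHS]/((fun w => - Ldot w s) v) -dE.
rewrite [in LHS](row_sum_delta v) linear_sum /= /dot mulr_suml -sumrN.
apply: eq_bigr => i _; rewrite linearZ /= dE !mxE partial_ell//.
by rewrite /GRing.scale/=; field.
Qed.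

(** On [Sdom mu] the partial derivative is a quotient of weighted transforms. *)
Lemma differentiable_partial_ell s i : Sdom mu s ->
  differentiable (partial (ell mu) i) s.
Proof.
move=> Ss.
have [dd _] := @is_diff_wlaplace _ _ mu (dot (delta_mx ord0 i))
  (measurable_dot _) (subexponential_dot _) s Ss.
have [d1 _] := is_diff_wlaplace1 Ss.
have L0 : L s != 0 by rewrite gt_eqF// wlaplace1_gt0.
have dq : differentiable ((- wlaplace mu (dot (delta_mx ord0 i))) * (fun y => (L y)^-1)) s.
  by apply: differentiableM; [exact: differentiableN|exact: differentiableV].
have dq' := differentiableP dq.
suff /near_eq_is_diff/(_ dq')[] :
  \forall y \near s, (- wlaplace mu (dot (delta_mx ord0 i)) * (fun y => (L y)^-1)) y =
                     partial (ell mu) i y by [].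
near=> y; rewrite partial_ell//; near: y; exact: near_Sdom.
Unshelve. all: by end_near. Qed.

Lemma mean_mapE s i : mean_map mu s ord0 i = - partial (ell mu) i s.
Proof. by rewrite !mxE. Qed.

Lemma differentiable_mean_map s : Sdom mu s -> differentiable (mean_map mu) s.
Proof.
move=> Ss; apply: differentiable_row => i.
have -> : (fun y => mean_map mu y ord0 i) = - partial (ell mu) i.
  by apply/funext => y; rewrite mean_mapE.
by apply: differentiableN; exact: differentiable_partial_ell.
Qed.

(** Row [i] of the Hessian holds the derivatives along [e_i] of all the partial
derivatives, so the Hessian multiplies row vectors from the right. *)
Lemma diff_mean_map s v : Sdom mu s ->
  'd (mean_map mu) s v = - (v *m hessian (ell mu) s).
Proof.
move=> Ss; apply/rowP => j; rewrite diff_row; last exact: differentiable_mean_map.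
have -> : (fun y => mean_map mu y ord0 j) = - partial (ell mu) j.
  by apply/funext => y; rewrite mean_mapE.
have dj := differentiable_partial_ell j Ss.
rewrite diffN// [in LHS](row_sum_delta v) !mxE -[LHS]/(- 'd (partial (ell mu) j) s _) linear_sum.
congr (- _); apply: eq_bigr => i _.
by rewrite linearZ /= !mxE -deriveE.
Qed.

End cumulants.

(** * Injectivity of the mean map *)

Section injectivity.
Context {R : realType} {n : nat}.
Context (mu : {measure set (borelRn R n) -> \bar R}).
Implicit Types (s t v x m : 'rV[R]_n).

Lemma measurable_hyperplaneC v (b : R) :
  measurable ([set x | dot v x - b != 0] : set (borelRn R n)).
Proof.
apply: sub_sigma_algebra.
apply: (@open_comp 'rV[R]_n R (fun x => dot v x - b) [set y | y != 0]).
  by move=> x _; apply: continuousB; [exact: dot_continuous|exact: cst_continuous].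
exact: open_neq.
Qed.

Lemma classM_hyperplaneC v (b : R) : classM mu -> v != 0 ->
  mu [set x | dot v x - b != 0] != 0%E.
Proof.
move=> [nH _] v0; apply/eqP => z.
apply: (nH [set x | dot v x = b]); first by exists v, b.
rewrite /concentrated_on -[RHS]z; congr (mu _); apply/seteqP; split => x /=.
  by move=> /eqP; rewrite subr_eq0.
by rewrite subr_eq0 => /eqP.
Qed.

Lemma measure_neq0_sub (A : set (borelRn R n)) : measurable A ->
  mu A != 0%E -> mu setT != 0%E.
Proof.
move=> mA; apply: contra => /eqP z.
by rewrite -measure_le0 -z le_measure ?inE.
Qed.

Lemma mulr_sub_expRN_ge0 (w : R) : 0 <= w * (1 - expR (- w)).
Proof.
case: (lerP 0 w) => w0.
  by rewrite mulr_ge0// subr_ge0 -expR0 ler_expR oppr_le0.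
by rewrite mulr_le0 ?(ltW w0)// subr_le0 -expR0 ler_expR oppr_ge0 ltW.
Qed.

Lemma mulr_sub_expRN_eq0 (w : R) : (w * (1 - expR (- w)) == 0) = (w == 0).
Proof.
rewrite mulf_eq0 subr_eq0 -[X in X == expR _]expR0 (inj_eq (@expR_inj R)).
by rewrite [0 == _]eq_sym oppr_eq0 orbb.
Qed.

(** This is strict convexity of the cumulant function, in the form of strict
monotonicity of its gradient: with [w(x) = <t - s, x - m>] the function
[w (1 - exp(- w)) exp(- <s, x>)] has integral zero when [m] is the mean at both
[s] and [t]. *)
Lemma mean_map_inj : classM mu -> {in Sdom mu &, injective (mean_map mu)}.
Proof.
move=> Mmu s t; rewrite !inE => Ss St mst; apply/eqP; rewrite eq_sym -subr_eq0.
apply: contraT => v0; set v := t - s in v0.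
set m := mean_map mu s in mst; pose b := dot v m.
have nH := classM_hyperplaneC b Mmu v0.
have mu0 := measure_neq0_sub (measurable_hyperplaneC v b) nH.
pose w x := dot v x - b.
have iw r : Sdom mu r -> mu.-integrable setT (EFin \o tilt r w).
  move=> Sr; have -> : EFin \o tilt r w =
      (fun x => (EFin \o tilt r (dot v)) x - (EFin \o tilt r (cst b)) x)%E.
    by apply/funext => x; rewrite /tilt /= -EFinB -mulrBl.
  exact: (integrableB measurableT (integrable_tilt_dot v Sr) (integrable_tilt_cst b Sr)).
have w0 r : Sdom mu r -> mean_map mu r = m -> wlaplace mu w r = 0.
  move=> Sr rm.
  have -> : wlaplace mu w r = wlaplace mu (dot v) r - b * wlaplace mu (cst 1) r.
    have i1 := integrable_tilt_cst 1 Sr.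
    have i2 := integrable_tilt_dot v Sr.
    have i3 : mu.-integrable setT (EFin \o (fun x => b * tilt r (cst 1) x)).
      exact: (integrableZl measurableT b i1).
    rewrite /wlaplace -(RintegralZl b measurableT i1) -(RintegralB measurableT i2 i3).
    by congr Rintegral; apply/funext => x; rewrite /tilt mul1r -mulrBl.
  rewrite (wlaplace_dot_mean mu0 v Sr) rm; exact: subrr.
pose f x := tilt s w x - expR b * tilt t w x.
(* exp(- <t, x>) = exp(- <s, x>) exp(- w(x)) exp(- b), whence the factor exp(b) *)
have fE x : f x = expR (- dot s x) * (w x * (1 - expR (- w x))).
  have -> : f x = tilt s w x - expR b * tilt t w x by [].
  rewrite /tilt.
  have -> : expR (- dot t x) = expR (- dot s x) * expR (- w x) / expR b.
    by rewrite -expRN -!expRD; congr expR; rewrite /w /v dotBl; ring.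
  by field; rewrite gt_eqF ?expR_gt0.
have ti := integrableZl measurableT (expR b) (iw _ St).
have fi : mu.-integrable setT (EFin \o f).
  exact: (integrableB measurableT (iw _ Ss) ti).
have f0 x : 0 <= f x by rewrite fE mulr_ge0 ?expR_ge0 ?mulr_sub_expRN_ge0.
have intf0 : Rintegral mu setT f = 0.
  rewrite (RintegralB measurableT (iw _ Ss) ti) (RintegralZl _ measurableT (iw _ St)).
  have := w0 _ St (esym mst); rewrite /wlaplace => ->.
  have := w0 _ Ss erefl; rewrite /wlaplace => ->.
  by rewrite mulr0 subr0.
have := Rintegral_eq0_null fi f0 intf0.
rewrite (_ : [set x | f x != 0] = [set x | w x != 0]).
  by move=> z; rewrite z eqxx in nH.
apply/seteqP; split=> x; rewrite /= fE mulf_eq0 (gt_eqF (expR_gt0 _));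
  by rewrite /= mulr_sub_expRN_eq0.
Qed.

End injectivity.

Lemma phiK (R : realType) (n : nat) (mu : {measure set (borelRn R n) -> \bar R}) s :
  classM mu -> Sdom mu s -> phi mu (mean_map mu s) = s.
Proof.
by move=> Mmu Ss; apply: pinvKV; [exact: mean_map_inj|rewrite inE].
Qed.

(** In dimension zero there are no hyperplanes and the zero measure satisfies
[classM], hence the dimension [n.+1]. *)
Lemma classM_neq0 (R : realType) (n : nat)
  (mu : {measure set (borelRn R n.+1) -> \bar R}) : classM mu -> mu setT != 0%E.
Proof.
move=> Mmu; have v0 : (delta_mx ord0 ord0 : 'rV[R]_n.+1) != 0.
  apply/eqP => /rowP/(_ ord0); rewrite !mxE !eqxx => /eqP.
  by rewrite oner_eq0.
exact: measure_neq0_sub (measurable_hyperplaneC _ 0) (classM_hyperplaneC 0 Mmu v0).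
Qed.

(** * Duality *)

(** The chain rule at [s] for [mean_map nu \o mean_map mu], which is the identity
near [s] because [Sdom mu] is open; the matrix identity is read off row by row,
by evaluating the differentials at the basis vectors. *)
Lemma hessian_dual (R : realType) (n : nat)
    (mu nu : {measure set (borelRn R n.+1) -> \bar R}) s :
  classM mu -> is_dual mu nu -> Sdom mu s ->
  hessian (ell mu) s *m hessian (ell nu) (mean_map mu s) = 1%:M.
Proof.
move=> Mmu [Mnu sub inv] Ss.
have mu0 := classM_neq0 Mmu; have nu0 := classM_neq0 Mnu.
have Sm : Sdom nu (mean_map mu s) by apply: sub; exists s.
have dmu := differentiable_mean_map mu0 Ss.
have dnu := differentiable_mean_map nu0 Sm.
have near_id : \forall y \near s, (mean_map nu \o mean_map mu) y = y.
  by near=> y; apply: inv; near: y; exact: near_Sdom.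
have [_ d_id] := near_eq_is_diff near_id (differentiableP (differentiable_comp dmu dnu)).
apply/row_matrixP => i; rewrite row_mul row1 rowE.
have id_id : 'd (fun y : 'rV[R]_n.+1 => y) s = id :> (_ -> _).
  exact: (@diff_val _ _ _ _ _ _ _ (is_diff_id s)).
have := etrans (esym id_id) (etrans d_id (diff_comp dmu dnu)).
move=> /(congr1 (fun f => f (delta_mx ord0 i))).
have jac := etrans (congr1 ('d (mean_map nu) (mean_map mu s))
  (diff_mean_map mu0 (delta_mx ord0 i) Ss)) (diff_mean_map nu0 _ Sm).
move=> id_d; have := etrans id_d jac; rewrite mulNmx opprK; exact: esym.
Unshelve. all: by end_near. Qed.

Theorem proposition1 (R : realType) (n : nat)
    (mu nu : {measure set (borelRn R n) -> \bar R})
    (hmu : classM mu) (hnu : is_dual mu nu) :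
  (forall m : 'rV[R]_n, domain_of_means mu m ->
     is_inverse_of (hessian (ell nu) m) (variance_function mu m)) /\
  (steep mu ->
   forall m : 'rV[R]_n, Sdom mu m ->
     is_inverse_of (hessian (ell mu) m) (variance_function nu m)).
Proof.
(* In dimension zero all matrices are equal and invertible. *)
case: n mu nu hmu hnu => [|n] mu nu hmu hnu.
  have inv0 (A V : 'M[R]_0) : is_inverse_of A V.
    by split; [rewrite unitmxE det_mx00 unitr1|rewrite [A]flatmx0 [RHS]flatmx0].
  by split=> *; exact: inv0.
have inv_of (A V : 'M[R]_n.+1) : A *m V = 1%:M -> is_inverse_of A V.
  move=> AV; have [_ uV] := mulmx1_unit AV; split=> //.
  by rewrite -[A]mulmx1 -(mulmxV uV) mulmxA AV mul1mx.
have [Mnu sub inv] := hnu; split=> [_ [s Ss <-]|_ s Ss]; apply: inv_of.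
  by rewrite /variance_function phiK//; apply: mulmx1C; exact: hessian_dual.
have Sm : Sdom nu (mean_map mu s) by apply: sub; exists s.
by rewrite /variance_function -[in phi nu _](inv s Ss) phiK//; exact: hessian_dual.
Qed.
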